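(* Let $G=(V,E,\sigma)$ be a finite graph with edge weights $\sigma\in\mathbb{R}_{>0}^E$ and let $\Gamma$ be a non-trivial finite family of objects on $G$ with usage matrix $\mathcal N$ and Fulkerson blocker $\hat\Gamma$. For a given $1<p<\infty$, let $q:=p/(p-1)$ and $\hat\sigma(e):=\sigma(e)^{-q/p}$ for $e\in E$. Let $\mu^*$ be an optimal probability mass function for the minimization problem $$\min_{\mu\in\mathcal P(\Gamma)}\ \sum_{e\in E}\sigma(e)^{-\frac qp}\,\mathbb{E}_\mu\big[\mathcal N(\underline\gamma,e)\big]^q,$$ and let $\eta^*$ be optimal for $\operatorname{Mod}_{q,\hat\sigma}(\hat\Gamma)$. Then $$\eta^*(e)=\mathbb{E}_{\mu^*}\big[\mathcal N(\underline\gamma,e)\big]\qquad\text{for all } e\in E.$$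
   Context: A finite family of objects $\Gamma$ on a finite graph $G=(V,E)$ is a finite set together with a usage matrix $\mathcal N=\mathcal N(\Gamma)\in\mathbb{R}_{\ge0}^{\Gamma\times E}$; $\mathcal N(\gamma,e)$ is the usage of edge $e$ by the object $\gamma$. The family is non-trivial if $\Gamma\neq\varnothing$ and each $\gamma\in\Gamma$ has $\mathcal N(\gamma,e)>0$ for at least one $e\in E$. The admissible set is $\operatorname{Adm}(\Gamma):=\{\rho\in\mathbb{R}_{\ge0}^E:\ \sum_{e\in E}\mathcal N(\gamma,e)\rho(e)\ge1\ \text{for all }\gamma\in\Gamma\}$. For $1\le p<\infty$ and weights $\sigma\in\mathbb{R}_{>0}^E$, $\mathcal E_{p,\sigma}(\rho):=\sum_{e\in E}\sigma(e)\rho(e)^p$ and $\operatorname{Mod}_{p,\sigma}(\Gamma):=\inf_{\rho\in\operatorname{Adm}(\Gamma)}\mathcal E_{p,\sigma}(\rho)$. A density is optimal if it is admissible and attains this infimum. The Fulkerson blocker $\hat\Gamma$ of $\Gamma$ is the (finite) set of extreme points of $\operatorname{Adm}(\Gamma)\subset\mathbb{R}_{\ge0}^E$, regarded as a family of objects whose usage matrix has the vectors $\hat\gamma^T$, $\hat\gamma\in\hat\Gamma$, as rows. $\mathcal P(\Gamma)$ is the set of probability mass functions on $\Gamma$, i.e. vectors $\mu\in\mathbb{R}_{\ge0}^\Gamma$ with $\sum_{\gamma\in\Gamma}\mu(\gamma)=1$. For $\mu\in\mathcal P(\Gamma)$, $\underline\gamma$ denotes a $\Gamma$-valued random variable with law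 $\mu$, so $\mathbb{E}_\mu[\mathcal N(\underline\gamma,e)]=\sum_{\gamma\in\Gamma}\mu(\gamma)\mathcal N(\gamma,e)$. *)

(* Defs.v *)
From HB Require Import structures.
From mathcomp Require Import all_boot all_order all_algebra.
From mathcomp Require Import finmap.
From mathcomp Require Import all_classical all_reals all_analysis.
From mathcomp Require Import lra.

Set Implicit Arguments.
Unset Strict Implicit.
Unset Printing Implicit Defensive.

Import Order.TTheory GRing.Theory Num.Theory.

Local Open Scope classical_set_scope.
Local Open Scope ring_scope.

(* Loops and parallel edges are allowed; the two ends of an edge are recorded
   as a pair, whose order is immaterial when the graph is undirected. *)
Record fin_graph := FinGraph {
  vertex : finType;
  edge : finType;
  ends : edge -> vertex * vertex }.

Definition density (R : realType) (G : fin_graph) := {ffun edge G -> R}.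

Record object_family (R : realType) (G : fin_graph) := Family {
  object : finType;
  usage : object -> edge G -> R;
  usage_ge0 : forall g e, 0 <= usage g e }.

Definition nontrivial (R : realType) (G : fin_graph) (Gam : object_family R G) : Prop :=
  (0 < #|object Gam|)%N /\
  (forall g : object Gam, exists e, 0 < usage g e).

Definition Adm (R : realType) (G : fin_graph) (Gam : object_family R G) :
    set (density R G) :=
  [set rho | (forall e, 0 <= rho e) /\
             (forall g : object Gam, 1 <= \sum_(e : edge G) usage g e * rho e)].

Definition energy (R : realType) (G : fin_graph) (p : R) (sigma : edge G -> R)
    (rho : density R G) : R :=
  \sum_(e : edge G) sigma e * rho e `^ p.

(* The infimum is taken in the extended reals, so it is +oo when [Adm Gam] is
   empty. *)
Definition Mod (R : realType) (G : fin_graph) (p : R) (sigma : edge G -> R)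
    (Gam : object_family R G) : \bar R :=
  ereal_inf [set (energy p sigma rho)%:E | rho in Adm Gam].

Definition optimal_density (R : realType) (G : fin_graph) (p : R)
    (sigma : edge G -> R) (Gam : object_family R G) (rho : density R G) : Prop :=
  Adm Gam rho /\ (energy p sigma rho)%:E = Mod p sigma Gam.

Definition extreme_points (R : realType) (G : fin_graph)
    (A : set (density R G)) : set (density R G) :=
  [set x | A x /\ forall (y z : density R G) (t : R), A y -> A z -> 0 < t < 1 ->
     (forall e, x e = t * y e + (1 - t) * z e) -> y = z].

Section BlockerFinite.
Variables (R : realType) (G : fin_graph) (Gam : object_family R G).

Let slack (rho : density R G) (i : edge G + object Gam) : R :=
  match i with
  | inl e => rho e
  | inr g => \sum_(e : edge G) usage g e * rho e - 1
  end.

Let AdmP (rho : density R G) : Adm Gam rho <-> forall i, 0 <= slack rho i.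
Proof.
split=> [[rho0 rho1] [e|g] /=|h]; first exact: rho0.
  by rewrite subr_ge0.
by split=> [e|g]; [have := h (inl e) | have := h (inr g); rewrite /= subr_ge0].
Qed.

Let slackE (x y z : density R G) (s : R) i :
  (forall e, z e = x e + s * (y e - x e)) ->
  slack z i = slack x i + s * (slack y i - slack x i).
Proof.
move=> zE; case: i => [e|g] /=; first exact: zE.
rewrite (eq_bigr (fun e => usage g e * x e + s *
    (usage g e * y e - usage g e * x e))); last first.
  by move=> e _; rewrite zE mulrDr mulrCA mulrBr.
by rewrite big_split /= -mulr_sumr sumrB; lra.
Qed.

Lemma finite_blocker : finite_set (extreme_points (Adm Gam)).
Proof.
pose f (rho : density R G) := [set i | slack rho i == 0]%SET.
suff f_inj : {in extreme_points (Adm Gam) &, injective f}.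
  by rewrite -(eq_finite_set (inj_card_eq f_inj)); exact: finite_finset.
move=> x y; rewrite !inE => -[xA xext] [yA _] /setP fxy.
have x0 i : 0 <= slack x i by move: i; exact/AdmP.
pose d i := slack y i - slack x i.
pose s := \big[Num.min/1]_(i | 0 < slack x i) (slack x i / (1 + `|d i|)).
have d1 i : 0 < 1 + `|d i| by rewrite ltr_pwDl.
have s0 : 0 < s by apply/bigmin_gtP; split=> // i xi; rewrite divr_gt0.
have sd i : s * `|d i| <= slack x i.
  have := x0 i; rewrite le_eqVlt => /orP[/eqP xi|xi].
    have := fxy i; rewrite !inE -xi eqxx => /esym/eqP yi.
    by rewrite /d yi -xi subrr normr0 mulr0.
  have : s <= slack x i / (1 + `|d i|) by exact: bigmin_le_cond.
  rewrite ler_pdivlMr// => h; apply: le_trans h.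
  by rewrite ler_pM2l// lerDr.
pose w (r : R) : density R G := [ffun e => x e + r * (y e - x e)].
have wA r : `|r| = s -> Adm Gam (w r).
  move=> rs; apply/AdmP => i.
  rewrite (@slackE x y (w r) r); last by move=> e; rewrite ffunE.
  have : `|r * d i| <= slack x i by rewrite normrM rs.
  by rewrite ler_norml => /andP[h _]; rewrite -/(d i); lra.
have wE : w s = w (- s).
  apply: (xext _ _ 2^-1); [| |lra|].
  - by apply: wA; rewrite gtr0_norm.
  - by apply: wA; rewrite normrN gtr0_norm.
  - by move=> e; rewrite !ffunE; lra.
apply/ffunP => e; have /ffunP/(_ e) := wE; rewrite !ffunE => we.
have /eqP : s * (y e - x e) = 0 by lra.
by rewrite mulf_eq0 gt_eqF//= subr_eq0 => /eqP.
Qed.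

End BlockerFinite.

Lemma blocker_usage_ge0 (R : realType) (G : fin_graph) (Gam : object_family R G)
    (x : fset_set (extreme_points (Adm Gam))) e :
  0 <= (fsval x : density R G) e.
Proof.
have := fsvalP x; rewrite (in_fset_set (finite_blocker Gam)) inE.
by case=> -[h _] _; exact: h.
Qed.

(* [fset_set A] is the finite set with the elements of [A] as soon as [A] is
   finite, which is [finite_blocker] here. *)
Definition blocker (R : realType) (G : fin_graph) (Gam : object_family R G) :
    object_family R G :=
  @Family R G (fset_set (extreme_points (Adm Gam)))
    (fun x => fsval x : density R G) (@blocker_usage_ge0 R G Gam).

Definition pmfs (R : realType) (G : fin_graph) (Gam : object_family R G) :
    set {ffun object Gam -> R} :=
  [set mu | (forall g, 0 <= mu g) /\ \sum_(g : object Gam) mu g = 1].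

Arguments pmfs {R G} Gam _.

Definition expected_usage (R : realType) (G : fin_graph) (Gam : object_family R G)
    (mu : {ffun object Gam -> R}) (e : edge G) : R :=
  \sum_(g : object Gam) mu g * usage g e.

Definition pmf_objective (R : realType) (G : fin_graph) (Gam : object_family R G)
    (p q : R) (sigma : edge G -> R) (mu : {ffun object Gam -> R}) : R :=
  \sum_(e : edge G) sigma e `^ (- (q / p)) * expected_usage mu e `^ q.

Definition optimal_pmf (R : realType) (G : fin_graph) (Gam : object_family R G)
    (p q : R) (sigma : edge G -> R) (mu : {ffun object Gam -> R}) : Prop :=
  pmfs Gam mu /\
  forall nu, pmfs Gam nu ->
    pmf_objective p q sigma mu <= pmf_objective p q sigma nu.

(* Main.v *)
Require Import Defs.
From HB Require Import structures.
From mathcomp Require Import all_boot all_order all_algebra.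
From mathcomp Require Import finmap.
From mathcomp Require Import all_classical all_reals all_analysis.
From mathcomp Require Import lra.

(** Write [u] for the expected usage of [mu], [w] for the dual weights and
    [E rho = \sum_e w e * rho e `^ q].  Both problems minimize the strictly
    convex function [E]: the first over the expected usages of pmfs, which form
    a convex hull, the second over [Adm (blocker Gam)], which contains that hull
    ([expected_usage_Adm_blocker]).  So [E eta <= E u], and it suffices that
    [u] be optimal for the larger problem too, with a strictness argument for
    uniqueness.

    A certificate of this optimality is read off from the first-order
    conditions.  Put [kappa e = w e * u e `^ (q - 1)], which is the gradient of
    [E] at [u] up to the factor [q], and [m = \sum_e kappa e * u e], which is
    [E u].  Moving [mu] towards the point mass at an object [g] cannot decrease
    [E], so [\sum_e kappa e * usage g e >= m] ([energy_first_order]).  As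
    [m > 0] by non-triviality, this says that [kappa / m] lies in [Adm Gam].

    Every density of [Adm (blocker Gam)] has inner product at least [1] with
    every density of [Adm Gam], and not only with its extreme points
    ([blocker_duality]): a nonnegative linear form on the polyhedron [Adm Gam]
    is bounded below by its values at extreme points
    ([extreme_point_below]).  Hence
    [\sum_e kappa e * eta e >= m = \sum_e kappa e * u e]: the
    linearization of [E] at [u] does not decrease from [u] to [eta].  If [eta]
    differed from [u], [E] would lie strictly above this linearization at [eta]
    ([energy_tangent_lt]), so [E eta > E u], a contradiction. *)

Set Implicit Arguments.
Unset Strict Implicit.
Unset Printing Implicit Defensive.

Import Order.TTheory GRing.Theory Num.Theory.
Import numFieldNormedType.Exports.

Local Open Scope classical_set_scope.
Local Open Scope ring_scope.

(** * Tangents of the power function *)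

(** The derivative of the power function is increasing, so the mean value
    theorem places the graph strictly above its tangents.  It applies on
    positive segments only, as [powR] is constant on negative numbers; the cases
    [a = 0] and [b = 0] are computed directly. *)
Lemma powR_tangent_lt (R : realType) (q a b : R) :
  1 < q -> 0 <= a -> 0 <= b -> a != b ->
  q * a `^ (q - 1) * (b - a) < b `^ q - a `^ q.
Proof.
move=> q1 a0 b0 ab; have q0 : 0 < q by lra.
have qn0 : q != 0 by rewrite gt_eqF.
have mvt (x y : R) : 0 < x -> x < y ->
    exists2 c, x < c < y & y `^ q - x `^ q = q * c `^ (q - 1) * (y - x).
  move=> x0 xy.
  have drv z : z \in `]x, y[%R ->
      is_derive z 1 (fun z => z `^ q) (q * z `^ (q - 1)).
    rewrite in_itv/= => /andP[xz _].
    by apply: is_derive1_powR; exact: lt_trans xz.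
  have cont : {within `[x, y], continuous (fun z => z `^ q)}.
    apply: derivable_within_continuous => z; rewrite in_itv/= => /andP[xz _].
    by apply: derivable_powR; rewrite in_itv/= andbT (lt_le_trans x0).
  by have [z] := MVT xy drv cont; rewrite in_itv/= => xzy zE; exists z.
move: a0 ab; rewrite le_eqVlt => /predU1P[<-|a0] ab.
  rewrite !powR0 ?subr_eq0 ?gt_eqF// mulr0 mul0r subr0 powR_gt0//.
  by rewrite lt_neqAle ab.
move: b0; rewrite le_eqVlt => /predU1P[<-|b0].
  rewrite powR0// sub0r mulrN -mulrA [_ * a]mulrC mulr_powRB1// ?ltW//.
  by rewrite sub0r ltrN2 -subr_gt0 -{2}[_ `^ _]mul1r -mulrBl mulr_gt0 ?powR_gt0 ?subr_gt0.
have mono (x y : R) : 0 < x -> x < y -> x `^ (q - 1) < y `^ (q - 1).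
  by move=> x0 xy; apply: gt0_ltr_powR => //; rewrite ?nnegrE; lra.
move: ab; rewrite neq_lt => /orP[ab|ba].
  have [c /andP[ac cb] ->] := mvt _ _ a0 ab.
  by rewrite ltr_pM2r ?subr_gt0// ltr_pM2l// mono.
have [c /andP[bc ca] E] := mvt _ _ b0 ba.
rewrite -(opprB (a `^ q)) E -(opprB a b) mulrN ltrN2.
by rewrite ltr_pM2r ?subr_gt0// ltr_pM2l// mono// (lt_trans b0).
Qed.

Lemma powR_tangent_le (R : realType) (q a b : R) :
  1 < q -> 0 <= a -> 0 <= b ->
  q * a `^ (q - 1) * (b - a) <= b `^ q - a `^ q.
Proof.
move=> q1 a0 b0; have [->|ab] := eqVneq a b; first by rewrite !subrr mulr0.
exact/ltW/powR_tangent_lt.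
Qed.

(** The limit is one-sided because [powR] is [1] on negative numbers, so it is
    only right-continuous at [a = 0]. *)
Lemma cvg_powR_segment (R : realType) (r a b : R) :
  0 < r -> 0 <= a -> 0 <= b ->
  (a + t * (b - a)) `^ r @[t --> 0^'+] --> a `^ r.
Proof.
move=> r0 a0 b0; move: a0; rewrite le_eqVlt => /predU1P[<-|a0].
  (* from the endpoint 0 the power splits as t `^ r * b `^ r *)
  have tb : t `^ r * b `^ r @[t --> 0^'+] --> 0 `^ r.
    rewrite powR0 ?gt_eqF// -[X in _ --> X](mul0r (b `^ r)).
    by apply: cvgM; [exact: powR_cvg0|exact: cvg_cst].
  apply: cvg_trans tb; apply: near_eq_cvg; near=> t.
  by rewrite add0r subr0 powRM.
apply: (@continuous_cvg _ _ _ _ _ (fun t : R => a + t * (b - a)) (fun z => z `^ r)).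
  apply: differentiable_continuous; apply/derivable1_diffP.
  by apply: derivable_powR; rewrite in_itv/= andbT.
rewrite -[X in _ --> X]addr0 -[X in _ --> _ + X](mul0r (b - a)).
apply: cvgD; first exact: cvg_cst.
by apply: cvgM; [exact: cvg_at_right_filter cvg_id|exact: cvg_cst].
Unshelve. all: by end_near. Qed.

(** * First-order conditions for the energy *)

Section EdgeSums.
Variables (R : realType) (G : fin_graph).
Implicit Types (w : edge G -> R) (x y : density R G).

Lemma energy_tangent_le (q : R) w x y :
  1 < q -> (forall e, 0 <= w e) -> (forall e, 0 <= x e) -> (forall e, 0 <= y e) ->
  q * (\sum_e w e * x e `^ (q - 1) * (y e - x e)) <= energy q w y - energy q w x.
Proof.
move=> q1 w0 x0 y0; rewrite /energy -sumrB mulr_sumr ler_sum// => e _.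
by rewrite -mulrBr -!mulrA mulrCA ler_wpM2l// mulrA powR_tangent_le.
Qed.

Lemma energy_tangent_lt (q : R) w x y :
  1 < q -> (forall e, 0 < w e) -> (forall e, 0 <= x e) -> (forall e, 0 <= y e) ->
  x != y ->
  q * (\sum_e w e * x e `^ (q - 1) * (y e - x e)) < energy q w y - energy q w x.
Proof.
move=> q1 w0 x0 y0 xy; have [e xye] : exists e, x e != y e.
  apply/existsP; apply: contraNT xy; rewrite negb_exists => /forallP h.
  by apply/eqP/ffunP => e; have := h e; rewrite negbK => /eqP.
rewrite /energy -sumrB mulr_sumr (bigD1 e)//= [ltRHS](bigD1 e)//=.
apply: ltr_leD => [|]; last apply: ler_sum => i _.
  by rewrite -mulrBr -!mulrA mulrCA ltr_pM2l// mulrA powR_tangent_lt.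
by rewrite -mulrBr -!mulrA mulrCA ler_pM2l// mulrA powR_tangent_le.
Qed.

(** The energy is not differentiated: the tangent inequality taken at the
    moving point [z = x + t (y - x)] and evaluated at [x] bounds
    [energy z - energy x] above by [t] times a slope at [z].  That slope is
    therefore nonnegative, and it converges to the one at [x]. *)
Lemma energy_first_order (q : R) w x y :
  1 < q -> (forall e, 0 <= w e) -> (forall e, 0 <= x e) -> (forall e, 0 <= y e) ->
  (forall t, 0 < t < 1 ->
     energy q w x <= energy q w [ffun e => x e + t * (y e - x e)]) ->
  0 <= \sum_e w e * x e `^ (q - 1) * (y e - x e).
Proof.
move=> q1 w0 x0 y0 xmin.
pose F t := \sum_e w e * (x e + t * (y e - x e)) `^ (q - 1) * (y e - x e).
have Fcvg : F t @[t --> 0^'+] --> \sum_e w e * x e `^ (q - 1) * (y e - x e).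
  apply: cvg_big => [|e _]; first exact: add_continuous.
  apply: cvgM; last exact: cvg_cst.
  apply: cvgM; first exact: cvg_cst.
  by apply: cvg_powR_segment => //; lra.
apply: (cvgr_to_ge Fcvg); near=> t.
have /andP[t0 t1] : 0 < t < 1.
  by apply/andP; split; near: t; [exact: nbhs_right_gt|exact: nbhs_right_lt].
pose z : density R G := [ffun e => x e + t * (y e - x e)].
have z0 e : 0 <= z e.
  rewrite ffunE (_ : _ + _ = (1 - t) * x e + t * y e); last by lra.
  by rewrite addr_ge0// mulr_ge0//; lra.
have := energy_tangent_le q1 w0 z0 x0.
have : energy q w x <= energy q w z by apply: xmin; rewrite t0.
(* z e - x e = t * (y e - x e), so the slope at z in direction x - z is - t * F t *)
rewrite (_ : \sum_e _ = - t * F t); last first.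
  rewrite mulr_sumr; apply: eq_bigr => e _; rewrite ffunE; lra.
move=> h1 h2; have : 0 <= q * (t * F t) by lra.
by rewrite mulrA pmulr_rge0// mulr_gt0//; lra.
Unshelve. all: by end_near. Qed.

End EdgeSums.

(** * Extreme points of the admissible polyhedron *)

Section Polyhedron.
Variables (R : realType) (G : fin_graph) (Gam : object_family R G).
Implicit Types (rho d x y z : density R G).

(** The admissible set is the polyhedron [threshold <= constraint]; signs and
    usages are indexed together so that activity of a constraint is treated
    uniformly. *)
Definition constraint d (i : edge G + object Gam) : R :=
  match i with
  | inl e => d e
  | inr g => \sum_e usage g e * d e
  end.

Definition threshold (i : edge G + object Gam) : R :=
  if i is inr _ then 1 else 0.

Lemma AdmE rho : Adm Gam rho <-> forall i, threshold i <= constraint rho i.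
Proof.
split=> [[rho0 rho1] [e|g]|h]; [exact: rho0 | exact: rho1 |].
by split=> [e|g]; [exact: (h (inl e)) | exact: (h (inr g))].
Qed.

Lemma constraint_lin (a b : R) x y z i :
  (forall e, z e = a * x e + b * y e) ->
  constraint z i = a * constraint x i + b * constraint y i.
Proof.
move=> zE; case: i => [e|g] /=; first exact: zE.
rewrite !mulr_sumr -big_split/=; apply: eq_bigr => e _.
by rewrite zE; lra.
Qed.

(** When [rho] lies strictly between [y] and [z], a constraint that is active at
    [rho] is active at both, hence constant along [d = y - z]. *)
Lemma nonextreme_direction rho : Adm Gam rho -> ~ extreme_points (Adm Gam) rho ->
  exists d, (exists e, d e != 0) /\
    forall i, constraint rho i = threshold i -> constraint d i = 0.
Proof.
move=> rhoA; apply: contra_notP => nod; split=> // y z t yA zA /andP[t0 t1] rhoE.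
apply/eqP; rewrite -subr_eq0; apply/negPn/negP => yz; apply: nod.
exists (y - z); split.
  apply/existsP; apply: contraNT yz; rewrite negb_exists => /forallP h.
  by apply/eqP/ffunP => e; have := h e; rewrite negbK [in RHS]ffunE => /eqP.
move=> i iE.
rewrite (@constraint_lin 1 (-1) y z); last by move=> e; rewrite !ffunE; lra.
move: iE; rewrite (constraint_lin i rhoE) => iE.
have yi := (AdmE y).1 yA i; have zi := (AdmE z).1 zA i.
nra.
Qed.

(** [Adm] lies in the nonnegative orthant, so it contains no line.  When [eta]
    does not vanish on [d], going down along [eta >= 0] forces some coordinate
    to decrease; when it does, either orientation is good and a nonzero
    coordinate chooses one. *)
Lemma descent_direction (eta : edge G -> R) d : (forall e, 0 <= eta e) ->
  (exists e, d e != 0) ->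
  exists c : R, c * (\sum_e eta e * d e) <= 0 /\ exists e, c * d e < 0.
Proof.
move=> eta0 [e de]; have [s0|s0|s0] := ltgtP (\sum_e eta e * d e) 0.
- exists 1; rewrite mul1r ltW//; split=> //; apply: contrapT => nod.
  move: s0; apply/negP; rewrite -leNgt sumr_ge0// => i _; rewrite mulr_ge0//.
  by rewrite leNgt; apply/negP => di; apply: nod; exists i; rewrite mul1r.
- exists (-1); rewrite mulN1r oppr_le0 ltW//; split=> //; apply: contrapT => nod.
  move: s0; apply/negP; rewrite -leNgt -oppr_ge0 -sumrN sumr_ge0// => i _.
  rewrite -mulrN mulr_ge0// leNgt.
  by apply/negP => di; apply: nod; exists i; rewrite mulN1r.
- (* the scalar - d e makes the coordinate e of the direction - (d e) ^+ 2 *)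
  exists (- d e); rewrite s0 mulr0; split=> //; exists e.
  by rewrite mulNr oppr_lt0 -expr2 exprn_even_gt0.
Qed.

(** From a point that is not extreme, move along a direction that keeps the
    active constraints active and does not increase [eta], up to the first
    constraint met.  That constraint becomes active, so the number of inactive
    constraints drops, and the process ends at an extreme point. *)
Lemma extreme_point_below (eta : edge G -> R) rho :
  (forall e, 0 <= eta e) -> Adm Gam rho ->
  exists2 x, extreme_points (Adm Gam) x &
    \sum_e eta e * x e <= \sum_e eta e * rho e.
Proof.
move=> eta0.
have [n] := ubnP #|[set i | constraint rho i != threshold i]%SET|.
elim: n rho => // n IH rho; rewrite ltnS => rhon rhoA.
have [rhoX|rhoNX] := pselect (extreme_points (Adm Gam) rho); first by exists rho.
have [d [d0 dT]] := nonextreme_direction rhoA rhoNX.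
have [c [cd [e0 ce0]]] := descent_direction eta0 d0.
have rhoT := (AdmE rho).1 rhoA.
(* the time at which the constraint i becomes active, if it decreases *)
pose step i := (constraint rho i - threshold i) / - (c * constraint d i).
case: (@Order.TotalTheory.arg_minP _ R _ (inl e0) (fun i => c * constraint d i < 0) step ce0).
move=> i ci imin.
have s0 : 0 <= step i by rewrite divr_ge0 ?subr_ge0// oppr_ge0 ltW.
pose x : density R G := [ffun e => rho e + step i * c * d e].
have xE j : constraint x j = constraint rho j + step i * (c * constraint d j).
  rewrite (@constraint_lin 1 (step i * c) rho d); first by rewrite mul1r mulrA.
  by move=> e; rewrite ffunE mul1r.
have xA : Adm Gam x.
  apply/AdmE => j; rewrite xE.
  have [cj|cj] := ltP (c * constraint d j) 0; last first.
    by rewrite (le_trans (rhoT j))// lerDl mulr_ge0.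
  have := imin j cj; rewrite {2}/step ler_pdivlMr ?oppr_gt0//; lra.
have [||y yX yx] := IH x; [|done|].
- apply: leq_trans rhon; apply: proper_card; apply/properP; split.
    apply/fintype.subsetP => j; rewrite !inE xE; apply: contra => /eqP jE.
    by rewrite (dT _ jE) jE mulr0 mulr0 addr0.
  exists i; rewrite !inE.
    by apply/eqP => iE; move: ci; rewrite (dT _ iE) mulr0 ltxx.
  rewrite negbK xE /step invrN mulrN mulNr divfK ?(ltr0_neq0 ci)//.
  by rewrite opprB addrC subrK.
- exists y => //; apply: le_trans yx _.
  rewrite (eq_bigr (fun e => eta e * rho e + step i * c * (eta e * d e))).
    by rewrite big_split/= -mulr_sumr -mulrA gerDl mulr_ge0_le0.
  by move=> e _; rewrite ffunE; lra.
Qed.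

Lemma blocker_duality (eta : density R G) rho :
  Adm (blocker Gam) eta -> Adm Gam rho -> 1 <= \sum_e eta e * rho e.
Proof.
move=> [eta0 eta1] rhoA; have [x xX xrho] := extreme_point_below eta0 rhoA.
apply: le_trans xrho.
have xB : x \in fset_set (extreme_points (Adm Gam)).
  by rewrite (in_fset_set (finite_blocker Gam)) inE.
have := eta1 [` xB]%fset; rewrite /=.
by under eq_bigr do rewrite mulrC.
Qed.

End Polyhedron.

(** * Expected usages *)

Section ExpectedUsage.
Variables (R : realType) (G : fin_graph) (Gam : object_family R G).

Lemma sum_expected_usage (mu : {ffun object Gam -> R}) (x : edge G -> R) :
  \sum_e expected_usage mu e * x e = \sum_g mu g * \sum_e usage g e * x e.
Proof.
under eq_bigr do rewrite mulr_suml.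
rewrite exchange_big/=; apply: eq_bigr => g _; rewrite mulr_sumr.
by apply: eq_bigr => e _; rewrite mulrA.
Qed.

Lemma expected_usage_ge0 (mu : {ffun object Gam -> R}) e :
  pmfs Gam mu -> 0 <= expected_usage mu e.
Proof. by move=> [mu0 _]; rewrite sumr_ge0// => g _; rewrite mulr_ge0// usage_ge0. Qed.

Lemma expected_usage_Adm_blocker (mu : {ffun object Gam -> R}) :
  pmfs Gam mu -> Adm (blocker Gam) [ffun e => expected_usage mu e].
Proof.
move=> muP; have [mu0 mu1] := muP; split=> [e|x].
  by rewrite ffunE expected_usage_ge0.
have : Adm Gam (fsval x).
  by have := fsvalP x; rewrite (in_fset_set (finite_blocker Gam)) inE => -[].
move=> [_ xA]; under eq_bigr do rewrite ffunE mulrC.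
rewrite sum_expected_usage -mu1; apply: ler_sum => g _.
by rewrite ler_peMr.
Qed.

(** The segment from [mu] to the point mass at [g]. *)
Definition pmf_mix (mu : {ffun object Gam -> R}) g t : {ffun object Gam -> R} :=
  [ffun h => mu h + t * ((h == g)%:R - mu h)].

Lemma pmf_mixP (mu : {ffun object Gam -> R}) g t :
  pmfs Gam mu -> 0 <= t <= 1 -> pmfs Gam (pmf_mix mu g t).
Proof.
move=> [mu0 mu1] /andP[t0 t1]; split=> [h|].
  rewrite ffunE (_ : _ + _ = (1 - t) * mu h + t * (h == g)%:R); last by lra.
  by rewrite addr_ge0// mulr_ge0//; lra.
under eq_bigr do rewrite ffunE.
rewrite big_split/= -mulr_sumr sumrB mu1 (bigD1 g)//= eqxx.
rewrite big1 ?addr0 ?subrr ?mulr0 ?addr0//.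
by move=> h /negbTE->.
Qed.

Lemma expected_usage_mix (mu : {ffun object Gam -> R}) g t e :
  expected_usage (pmf_mix mu g t) e =
  expected_usage mu e + t * (usage g e - expected_usage mu e).
Proof.
rewrite /expected_usage.
under eq_bigr do rewrite ffunE mulrDl -mulrA mulrBl.
rewrite big_split/= -mulr_sumr sumrB; congr (_ + _ * (_ - _)).
rewrite (bigD1 g)//= eqxx mul1r big1 ?addr0// => h /negbTE->.
by rewrite mul0r.
Qed.

Lemma exists_expected_usage_gt0 (mu : {ffun object Gam -> R}) :
  (forall g : object Gam, exists e, 0 < usage g e) -> pmfs Gam mu ->
  exists e, 0 < expected_usage mu e.
Proof.
move=> Gam0 [mu0 mu1].
have [g g0] : exists g, 0 < mu g.
  apply: contrapT => nomu; have : \sum_g mu g <= 0.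
    by apply: sumr_le0 => g _; rewrite leNgt; apply/negP => g0; apply: nomu; exists g.
  by rewrite mu1 ler10.
have [e ge] := Gam0 g; exists e.
rewrite /expected_usage (bigD1 g)//= ltr_pwDl ?mulr_gt0// sumr_ge0// => h _.
by rewrite mulr_ge0 ?usage_ge0.
Qed.

End ExpectedUsage.

(** * Optimality *)

Theorem theorem5p1 (R : realType) (G : fin_graph) (sigma : edge G -> R)
    (sigma_gt0 : forall e, 0 < sigma e)
    (Gam : object_family R G) (Gam_nontrivial : nontrivial Gam)
    (p q : R) (p_gt1 : 1 < p) (qE : q = p / (p - 1))
    (sigmahat : edge G -> R)
    (sigmahatE : forall e, sigmahat e = sigma e `^ (- (q / p)))
    (mu : {ffun object Gam -> R}) (mu_opt : optimal_pmf p q sigma mu)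
    (eta : density R G) (eta_opt : optimal_density q sigmahat (blocker Gam) eta) :
  forall e : edge G, eta e = expected_usage mu e.
Proof.
have q1 : 1 < q by rewrite qE ltr_pdivlMr; lra.
have w0 e : 0 < sigmahat e by rewrite sigmahatE powR_gt0.
have [muP mumin] := mu_opt; have [etaA etaE] := eta_opt.
have objE nu : pmf_objective p q sigma nu =
    energy q sigmahat [ffun e => expected_usage nu e].
  by apply: eq_bigr => e _; rewrite ffunE sigmahatE.
pose u : density R G := [ffun e => expected_usage mu e].
have u0 e : 0 <= u e by rewrite ffunE expected_usage_ge0.
have [eta0 _] := etaA.
have eta_le : energy q sigmahat eta <= energy q sigmahat u.
  rewrite -lee_fin etaE; apply: ereal_inf_lbound; exists u => //.
  exact: expected_usage_Adm_blocker.
pose kappa e := sigmahat e * u e `^ (q - 1).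
pose m := \sum_e kappa e * u e.
have kappa0 e : 0 <= kappa e by rewrite mulr_ge0 ?powR_ge0 ?ltW.
have m0 : 0 < m.
  have [e ue] := exists_expected_usage_gt0 Gam_nontrivial.2 muP.
  rewrite /m (bigD1 e)//= ltr_pwDl//.
    by rewrite !mulr_gt0 ?powR_gt0// ffunE.
  by rewrite sumr_ge0// => i _; rewrite mulr_ge0.
have kappaA : Adm Gam [ffun e => kappa e / m].
  split=> [e|g]; first by rewrite ffunE divr_ge0// ltW.
  under eq_bigr do rewrite ffunE mulrA.
  rewrite -mulr_suml ler_pdivlMr// mul1r -subr_ge0 -sumrB.
  rewrite (eq_bigr (fun e => sigmahat e * u e `^ (q - 1) *
      ([ffun e => usage g e] e - u e))); last first.
    by move=> e _; rewrite [in RHS]ffunE /kappa; lra.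
  apply: energy_first_order => // [e|e|t /andP[t0 t1]].
  - exact: ltW.
  - by rewrite ffunE usage_ge0.
  - rewrite -objE; apply: (le_trans (mumin (pmf_mix mu g t) _)).
      by apply: pmf_mixP => //; rewrite !ltW.
    rewrite objE le_eqVlt; apply/orP; left; apply/eqP; congr energy.
    by apply/ffunP => e; rewrite !ffunE expected_usage_mix.
move=> e; rewrite -[RHS](ffunE (fun e => expected_usage mu e)) -/u.
congr (fun_of_fin _ e); apply/esym/eqP/negPn/negP => ueta.
have := energy_tangent_lt q1 w0 u0 eta0 ueta.
suff : 0 <= \sum_e kappa e * (eta e - u e).
  rewrite -/kappa => h; have : 0 <= q * \sum_e kappa e * (eta e - u e).
    by rewrite mulr_ge0//; lra.
  rewrite /kappa; lra.
under eq_bigr do rewrite mulrBr.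
rewrite sumrB subr_ge0 -/m.
have := blocker_duality etaA kappaA.
under eq_bigr do rewrite ffunE mulrA.
rewrite -mulr_suml ler_pdivlMr// mul1r.
by under eq_bigr do rewrite mulrC.
Qed.
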